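(* Let $\alpha\in(0,1)$ be irrational. For every $\beta\in[0,\tfrac12)$ define $R_n(\alpha,\beta)$, for integers $n\ge0$, by $S_n(\alpha,\beta)=S_n(\alpha)+R_n(\alpha,\beta)$. Then for every integer $n\ge1$ $$R_{n-1}(\alpha,\beta)=2\Big[d_n\big(\alpha,\tfrac12-\beta\big)-d_n(\alpha,1-\beta)-d_n\big(\alpha,\tfrac12\big)\Big].$$
   Context: $\{\cdot\}$ is the fractional part. Put $s(y):=2\chi_{[0,1/2)}(\{y\})-1$, $S_n(\alpha,\beta):=\sum_{r=0}^{n}s(r\alpha+\beta)$ and $S_n(\alpha):=S_n(\alpha,0)$. For $\beta\in(0,1]$, $d_n(\alpha,\beta):=\sum_{r=0}^{n-1}\chi_{[0,\beta)}(\{r\alpha\})-\beta n$. *)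

(* Defs.v *)
From mathcomp Require Import all_boot all_order all_algebra.
From mathcomp Require Import boolp classical_sets set_interval reals numfun.
Set Implicit Arguments.
Unset Strict Implicit.
Unset Printing Implicit Defensive.
Import Order.TTheory GRing.Theory Num.Theory.
Local Open Scope ring_scope.

Definition frac_part (R : realType) (y : R) : R := y - (Num.floor y)%:~R.

Definition s (R : realType) (y : R) : R := 2 * \1_(`[0, 1 / 2[%classic) (frac_part y) - 1.

(* The sum has n + 1 terms, r = 0, ..., n. *)
Definition S_sum (R : realType) (n : nat) (alpha beta : R) : R :=
  \sum_(0 <= r < n.+1) s (r%:R * alpha + beta).

Definition S_sum0 (R : realType) (n : nat) (alpha : R) : R := S_sum n alpha 0.

(* Meant for beta in (0, 1]; the sum has n terms, r = 0, ..., n - 1. *)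
Definition discr (R : realType) (n : nat) (alpha beta : R) : R :=
  \sum_(0 <= r < n) \1_(`[0, beta[%classic) (frac_part (r%:R * alpha)) - beta * n%:R.

(* The unique solution of S_sum n alpha beta = S_sum0 n alpha + R_rem n alpha beta. *)
Definition R_rem (R : realType) (n : nat) (alpha beta : R) : R :=
  S_sum n alpha beta - S_sum0 n alpha.

(* Main.v *)
Require Import Defs.
From mathcomp Require Import all_boot all_order all_algebra.
From mathcomp Require Import boolp classical_sets set_interval reals numfun.
From mathcomp Require Import lra.
Import Order.TTheory GRing.Theory Num.Theory.
Local Open Scope ring_scope.

(** The identity holds term by term, and each term is a statement about one
    point [x] of the circle, here the fractional part of [r * alpha].
    Translating by [beta < 1/2], the point [x + beta] falls in the half circle
    [[0, 1/2)] exactly when [x] lies in [[0, 1/2 - beta)] (no wrap-around) or in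
    [[1 - beta, 1)] (wrap-around past 1).  The second arc is the complement of
    [[0, 1 - beta)], so the indicator of the half circle at [x + beta] is
    [1_[0, 1/2 - beta) + 1 - 1_[0, 1 - beta)] at [x]
    (lemma [indic_half_frac_part_shift]).  Subtracting [1_[0, 1/2)] for the
    unshifted orbit and summing over [r < n] leaves three counting functions
    plus the constant [n]; this constant is what the mean values subtracted in
    the three discrepancies add up to, since
    [(1/2 - beta) - (1 - beta) - 1/2 = -1]. *)

Lemma frac_part_bounds (R : realType) (y : R) : 0 <= frac_part y < 1.
Proof.
have /andP[ge_fl lt_fl] := floor_itv y.
by rewrite /frac_part; rewrite intrD in lt_fl; apply/andP; split; lra.
Qed.

Lemma frac_part_unique (R : realType) (y x : R) (k : int) :
  0 <= x < 1 -> y = x + k%:~R -> frac_part y = x.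
Proof.
move=> /andP[x0 x1] ->; rewrite /frac_part.
have -> : Num.floor (x + k%:~R) = k.
  by apply: floor_def; rewrite intrD; apply/andP; split; lra.
by rewrite addrK.
Qed.

Lemma indic_itv0 (R : realType) (b x : R) :
  0 <= x -> \1_(`[0, b[%classic) x = (x < b)%R%:R :> R.
Proof. by move=> x0; rewrite indicE mem_setE in_itv /= x0. Qed.

(** In the wrapped case, [x + beta - 1 < beta < 1/2] lands in the half circle
    automatically, which is where [beta <= 1/2] is used. *)
Lemma indic_half_frac_part_shift (R : realType) (beta y : R) :
  0 <= beta <= 1 / 2 ->
  \1_(`[0, 1 / 2[%classic) (frac_part (y + beta)) =
  \1_(`[0, 1 / 2 - beta[%classic) (frac_part y) + 1
  - \1_(`[0, 1 - beta[%classic) (frac_part y) :> R.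
Proof.
move=> /andP[b0 b1]; have /andP[x0 x1] := frac_part_bounds _ y.
have yE : y = frac_part y + (Num.floor y)%:~R by rewrite subrK.
have /andP[z0 _] := frac_part_bounds _ (y + beta).
rewrite !indic_itv0 //.
have [lt_x|ge_x] := ltP (frac_part y) (1 - beta).
  rewrite (frac_part_unique _ _ (frac_part y + beta) (Num.floor y)).
  - by rewrite ltrBrDr addrK.
  - by apply/andP; split; lra.
  - by rewrite {1}yE addrAC.
rewrite (frac_part_unique _ _ (frac_part y + beta - 1) (Num.floor y + 1)).
- have -> : (frac_part y + beta - 1 < 1 / 2) = true by apply/idP; lra.
  have -> : (frac_part y < 1 / 2 - beta) = false by apply/negbTE; lra.
  by rewrite add0r subr0.
- by apply/andP; split; lra.
- by rewrite {1}yE intrD; lra.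
Qed.

Theorem theorem4p4 (R : realType) (alpha : R)
    (alpha_bounds : 0 < alpha < 1) (alpha_irr : irrational alpha)
    (beta : R) (beta_bounds : 0 <= beta < 1 / 2)
    (n : nat) (n_ge1 : (1 <= n)%N) :
  R_rem n.-1 alpha beta =
  2 * (discr n alpha (1 / 2 - beta) - discr n alpha (1 - beta)
       - discr n alpha (1 / 2)).
Proof.
have bb : 0 <= beta <= 1 / 2 by case/andP: beta_bounds => -> /ltW ->.
have termE (r : nat) : s (r%:R * alpha + beta) - s (r%:R * alpha + 0) =
    2 * (\1_(`[0, 1 / 2 - beta[%classic) (frac_part (r%:R * alpha))
         - \1_(`[0, 1 - beta[%classic) (frac_part (r%:R * alpha))
         - \1_(`[0, 1 / 2[%classic) (frac_part (r%:R * alpha)) + 1).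
  by rewrite /s addr0 indic_half_frac_part_shift //; lra.
rewrite /R_rem /S_sum0 /S_sum prednK // -sumrB.
rewrite (eq_bigr _ (fun r _ => termE r)) -mulr_sumr big_split /= !sumrB.
by rewrite sumr_const_nat subn0 /discr; lra.
Qed.
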